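(* Let $1\le\nu<\infty$, let $\phi(z)=az+b$ with $0<|a|<1$, $b\in\mathbb{C}$, and let $w$ be an entire function, not identically zero, such that $W_{w,\phi}$ is a compact operator on $\mathcal{F}^\nu$. Then the point spectrum of $W_{w,\phi}$ consists of simple eigenvalues.
   Context: For $1\le\nu<\infty$, $\mathcal{F}^\nu$ is the space of entire functions $f$ with $\|f\|_\nu:=\left(\frac{\nu}{2\pi}\int_{\mathbb{C}}|f(z)|^\nu e^{-\nu|z|^2/2}\,dm(z)\right)^{1/\nu}<\infty$. $W_{w,\phi}f=w\,(f\circ\phi)$. *)

(* Defs.v *)
From HB Require Import structures.
From mathcomp Require Import all_boot all_order all_algebra.
From mathcomp Require Import all_classical all_reals all_analysis.
From mathcomp Require Import complex.
Set Implicit Arguments. Unset Strict Implicit. Unset Printing Implicit Defensive.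
Import Order.TTheory GRing.Theory Num.Theory.
Import numFieldNormedType.Exports.
Local Open Scope ring_scope.
Local Open Scope complex_scope.
Local Open Scope classical_set_scope.

Section Fock.
Variable R : realType.

Definition cmod (z : R[i]) : R :=
  let: Complex x y := z in Num.sqrt (x ^+ 2 + y ^+ 2).

Definition cpt (p : R * R) : R[i] := Complex p.1 p.2.

Definition entire (f : R[i] -> R[i]) : Prop :=
  forall z : R[i], exists d : R[i], forall e : R, 0 < e ->
    exists del : R, 0 < del /\
      forall h : R[i], 0 < cmod h -> cmod h < del ->
        cmod ((f (z + h) - f z) / h - d) < e.

Definition fock_integral (nu : R) (f : R[i] -> R[i]) : \bar R :=
  (\int[(@lebesgue_measure R \x @lebesgue_measure R)%E]_(p in setT)
     ((cmod (f (cpt p))) `^ nu * expR (- (nu * cmod (cpt p) ^+ 2) / 2))%:E)%E.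

Definition in_fock (nu : R) (f : R[i] -> R[i]) : Prop :=
  entire f /\ (fock_integral nu f < +oo)%E.

Definition fock_norm (nu : R) (f : R[i] -> R[i]) : R :=
  (nu / (2 * pi) * fine (fock_integral nu f)) `^ (1 / nu).

Definition wco (w phi : R[i] -> R[i]) (f : R[i] -> R[i]) : R[i] -> R[i] :=
  fun z => w z * f (phi z).

Definition wco_compact (nu : R) (w phi : R[i] -> R[i]) : Prop :=
  (forall f, in_fock nu f -> in_fock nu (wco w phi f)) /\
  forall u : nat -> (R[i] -> R[i]),
    (forall n, in_fock nu (u n)) -> (forall n, fock_norm nu (u n) <= 1) ->
    exists s : nat -> nat, (forall k, (s k < s k.+1)%N) /\
      exists g, in_fock nu g /\
        (fun k => fock_norm nu (fun z => wco w phi (u (s k)) z - g z))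
          @ \oo --> (0 : R).

Definition wco_eigen (nu : R) (w phi : R[i] -> R[i]) (lam : R[i])
    (f : R[i] -> R[i]) : Prop :=
  in_fock nu f /\ (exists z, f z != 0) /\ forall z, wco w phi f z = lam * f z.

End Fock.

(* Main.v *)
(** Let [z0] be the fixed point of [phi]. If [w (f o phi) = lam f] and [f]
vanishes at [z0] to the exact order [m], comparison of lowest order terms
gives [lam = w(z0) a^m]; as [0 < |a| < 1] and [lam <> 0], the eigenvalue
determines [m]. If [g] is another nonzero eigenfunction, it also has order
[m], and [c] can be chosen so that [g - c f] vanishes to a higher order; hence
[g = c f]. The case [lam = 0] is excluded because a product of nonzero entire
functions is nonzero.

The lowest order term comes from Cauchy's formula on the square [-1, 1]^2:
with [E_m(z)] the integral of [F(u) / (u^m (u - z)) du], one has [F(z) E(z) =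
E_0(z)] with [E] the same integral for [F = 1] and [m = 0], while [E_m(z) =
E_m(0) + z E_{m+1}(z)] and [|E_m|] is bounded uniformly in [m] for [|z| <=
1/2]. *)

Require Import Defs.
From HB Require Import structures.
From mathcomp Require Import all_boot all_order all_algebra.
From mathcomp Require Import all_classical all_reals all_analysis.
From mathcomp Require Import complex.
From mathcomp Require Import ring lra.
Import Order.TTheory GRing.Theory Num.Theory.
Local Open Scope ring_scope.
Local Open Scope complex_scope.

(** * Continuity and complex differentiability *)

Section NumField.
Set Implicit Arguments.
Unset Strict Implicit.
Import numFieldNormedType.Exports.
Variable K : numFieldType.
Implicit Types (F G : K -> K) (z c : K).

(* Sealed in inductive wrappers over an abstract [K]: on the concrete [R[i]],
   comparing the unfolded topological statements does not terminate in practice. *)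
Variant cts F z : Prop := Cts of {for z, continuous F}.
Variant cdiff F z : Prop := Cdiff of derivable F z 1.

Lemma cts_cst c z : cts (fun=> c) z.
Proof. by split; exact: cst_continuous. Qed.

Lemma cts_id z : cts id z.
Proof. by split => A. Qed.

Lemma ctsD F G z : cts F z -> cts G z -> cts (fun t => F t + G t) z.
Proof. by case=> cF [cG]; split; exact: continuousD. Qed.

Lemma ctsB F G z : cts F z -> cts G z -> cts (fun t => F t - G t) z.
Proof. by case=> cF [cG]; split; exact: continuousB. Qed.

Lemma ctsM F G z : cts F z -> cts G z -> cts (fun t => F t * G t) z.
Proof. by case=> cF [cG]; split; exact: continuousM. Qed.

Lemma ctsV F z : F z != 0 -> cts F z -> cts (fun t => (F t)^-1) z.
Proof. by move=> F0 [cF]; split; exact: continuousV. Qed.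

Lemma cdiff_cts F z : cdiff F z -> cts F z.
Proof. by case=> /derivable1_diffP/differentiable_continuous. Qed.

Lemma cdiff_cst c z : cdiff (fun=> c) z.
Proof. by split; exact: derivable_cst. Qed.

Lemma cdiff_id z : cdiff id z.
Proof. by split; exact: derivable_id. Qed.

Lemma cdiffD F G z : cdiff F z -> cdiff G z -> cdiff (fun t => F t + G t) z.
Proof. by case=> dF [dG]; split; exact: (@derivableD K K K F G z 1). Qed.

Lemma cdiffB F G z : cdiff F z -> cdiff G z -> cdiff (fun t => F t - G t) z.
Proof. by case=> dF [dG]; split; exact: (@derivableB K K K F G z 1). Qed.

Lemma cdiffM F G z : cdiff F z -> cdiff G z -> cdiff (fun t => F t * G t) z.
Proof. by case=> dF [dG]; split; exact: (@derivableM K K F G z 1). Qed.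

Lemma cdiffX F n z : cdiff F z -> cdiff (fun t => F t ^+ n) z.
Proof.
move=> dF; elim: n => [|n IHn].
  by under eq_fun do rewrite expr0; exact: cdiff_cst.
by under eq_fun do rewrite exprS; exact: cdiffM.
Qed.

Lemma cdiffV F z : F z != 0 -> cdiff F z -> cdiff (fun t => (F t)^-1) z.
Proof. by move=> F0 [dF]; split; exact: (@derivableV K K F z 1). Qed.

Lemma ctsP F z : cts F z <-> forall e : K, 0 < e ->
  exists2 d : K, 0 < d & forall t, `|z - t| < d -> `|F z - F t| < e.
Proof.
split=> [[/cvgrPdist_lt cF] e e0|H].
  have := cF e e0; rewrite -nbhs_nearE => /nbhs_ballP [d /= d0 hd].
  by exists d.
split; have FF := nbhs_filter z.
apply/(@cvgrPdist_lt K K K (nbhs z) FF) => e e0; have [d d0 hd] := H e e0.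
by exists d.
Qed.

Lemma cdiffP F z : cdiff F z <-> exists D : K, forall e : K, 0 < e ->
  exists2 d : K, 0 < d & forall h, h != 0 -> `|h| < d -> `|(F (z + h) - F z) / h - D| < e.
Proof.
have E h : h^-1 *: (F (h *: 1 + z) - F z) = (F (z + h) - F z) / h.
  by rewrite [h *: 1]mulr1 [h + z]addrC [LHS]mulrC.
split=> [[dF]|[D HD]].
  exists ('D_1 F z) => e e0.
  have /cvgrPdist_lt/(_ e e0) := dF.
  rewrite -nbhs_nearE => -[d /= d0 hd]; exists d => // h h0 hlt.
  rewrite distrC -E; apply: hd => //=.
  by rewrite sub0r normrN.
split; apply/cvg_ex; exists D; apply/cvgrPdist_lt => e e0.
have [d d0 hd] := HD e e0.
exists d => //= h; rewrite /ball_ /= sub0r normrN => hlt h0.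
by rewrite E distrC; apply: hd.
Qed.

End NumField.

(** * Integrals of continuous real functions *)

Section RealIntegral.
Set Implicit Arguments.
Unset Strict Implicit.
Import numFieldNormedType.Exports.
Local Open Scope classical_set_scope.
Variable R : realType.
Implicit Types (x y c t : R) (u v : R -> R).
Local Notation mu := (@lebesgue_measure R).

Definition Rint x y u : R := \int[mu]_(t in `[x, y]) u t.

(** Continuity at the end points is that of a function on the whole line; this is what restricting a
    function continuous in the plane to a side of a rectangle provides. *)
Definition ctson x y u := forall t, x <= t <= y -> {for t, continuous u}.

Lemma ctson_integrable x y u : ctson x y u -> mu.-integrable `[x, y] (EFin \o u).
Proof.
move=> cu; apply: continuous_compact_integrable; first exact: segment_compact.
apply: continuous_in_subspaceT => t; rewrite inE/= in_itv/=; exact: cu.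
Qed.

Lemma Rint_cst x y c : x <= y -> Rint x y (fun=> c) = c * (y - x).
Proof.
move=> xy; rewrite /Rint Rintegral_cst //= lebesgue_measure_itv /= lte_fin.
by move: xy; rewrite le_eqVlt => /predU1P[->|->]; rewrite // ltxx subrr.
Qed.

Lemma eq_Rint x y u v : (forall t, x <= t <= y -> u t = v t) ->
  Rint x y u = Rint x y v.
Proof. by move=> uv; apply: eq_Rintegral => t; rewrite inE/= in_itv/=; exact: uv. Qed.

Lemma RintD x y u v : ctson x y u -> ctson x y v ->
  Rint x y (fun t => u t + v t) = Rint x y u + Rint x y v.
Proof. by move=> cu cv; rewrite /Rint RintegralD//; exact: ctson_integrable. Qed.

Lemma RintZ x y c u : ctson x y u -> Rint x y (fun t => c * u t) = c * Rint x y u.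
Proof. by move=> cu; rewrite /Rint RintegralZl//; exact: ctson_integrable. Qed.

Lemma ctson_cst x y c : ctson x y (fun=> c).
Proof. by move=> t _; exact: cst_continuous. Qed.

Lemma le_Rint x y u v : ctson x y u -> ctson x y v ->
  (forall t, x <= t <= y -> u t <= v t) -> Rint x y u <= Rint x y v.
Proof.
move=> cu cv uv; apply: le_Rintegral => //; exact: ctson_integrable.
Qed.

Lemma Rint_chasles x m y u : x <= m <= y -> ctson x y u ->
  Rint x y u = Rint x m u + Rint m y u.
Proof.
move=> /andP[xm my] cu; apply/eqP; rewrite addrC -subr_eq; apply/eqP.
have iu := ctson_integrable cu.
(* The subtraction leaves a half-open interval; its missing end point [m] has measure zero. *)
rewrite /Rint Rintegral_itvB// ?bnd_simp//.
apply: Rintegral_itv_obnd_cbnd; apply: integrableS iu => //.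
by apply: subset_itvr; rewrite ?bnd_simp.
Qed.

Lemma Rint_bound x y u B : x <= y -> ctson x y u ->
  (forall t, x <= t <= y -> `|u t| <= B) -> `|Rint x y u| <= B * (y - x).
Proof.
move=> xy cu uB; rewrite -Rint_cst// ler_norml.
rewrite -mulN1r -RintZ; last exact: ctson_cst.
apply/andP; split; apply: le_Rint => //; try exact: ctson_cst.
  by move=> t /uB; rewrite ler_norml mulN1r => /andP[].
by move=> t /uB; rewrite ler_norml => /andP[].
Qed.

End RealIntegral.

(** * Bisection of rectangles *)

Section Bisection.
Set Implicit Arguments.
Unset Strict Implicit.
Local Open Scope classical_set_scope.
Variable R : realType.
Implicit Types (a b c d x y p q : R).

(** The supremum of the left end points works: comparison at the index [maxn m n] puts each [a m]
    below each [b n]. *)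
Lemma nested_intervals (a b : nat -> R) :
  (forall n, a n <= a n.+1) -> (forall n, b n.+1 <= b n) ->
  (forall n, a n <= b n) -> exists p, forall n, a n <= p <= b n.
Proof.
move=> a_incr b_decr ab.
have a_homo : {homo a : m n / (m <= n)%N >-> m <= n} by apply: homo_leq (@le_trans _ _) _ => // *.
have b_homo : {homo b : m n / (m <= n)%N >-> n <= m}.
  by apply: (@homo_leq _ _ (fun x y => y <= x)) => // x y z xy /le_trans; apply.
have a_le_b m n : a m <= b n.
  apply: (le_trans (a_homo _ _ (leq_maxl m n))).
  by apply: (le_trans (ab _)); apply: b_homo; exact: leq_maxr.
have has_sup_a : has_sup (range a).
  by split; [exists (a 0%N), 0%N|exists (b 0%N) => _ [n _ <-]].
exists (sup (range a)) => n; apply/andP; split.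
  by apply: sup_upper_bound => //; exists n.
by apply: ge_sup => [|_ [m _ <-]]; [exists (a 0%N), 0%N|exact: a_le_b].
Qed.

(** If [P] fails on a rectangle, it fails on one of the four quarters. Repeated halving yields
    nested bad rectangles that shrink to a point, near which [P] holds by the last hypothesis. This
    one argument serves both Goursat's estimate and the boundedness of continuous functions. *)
Lemma rectangle_bisection (P : R -> R -> R -> R -> Prop) x1 x2 y1 y2 :
  x1 <= x2 -> y1 <= y2 ->
  (forall a b c d, x1 <= a -> a <= b -> b <= x2 -> y1 <= c -> c <= d -> d <= y2 ->
    P a ((a + b) / 2) c ((c + d) / 2) -> P ((a + b) / 2) b c ((c + d) / 2) ->
    P a ((a + b) / 2) ((c + d) / 2) d -> P ((a + b) / 2) b ((c + d) / 2) d ->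
    P a b c d) ->
  (forall p q, x1 <= p <= x2 -> y1 <= q <= y2 ->
    exists2 e, 0 < e & forall a b c d, x1 <= a -> a <= p <= b -> b <= x2 ->
      y1 <= c -> c <= q <= d -> d <= y2 -> (b - a) + (d - c) < e -> P a b c d) ->
  P x1 x2 y1 y2.
Proof.
move=> x12 y12 step small; apply: contrapT => NP.
pose bad (s : (R * R) * (R * R)) :=
  [/\ [/\ x1 <= s.1.1, s.1.1 <= s.1.2 & s.1.2 <= x2],
      [/\ y1 <= s.2.1, s.2.1 <= s.2.2 & s.2.2 <= y2] &
      ~ P s.1.1 s.1.2 s.2.1 s.2.2].
pose half (s s' : (R * R) * (R * R)) :=
  [/\ s.1.1 <= s'.1.1, s'.1.2 <= s.1.2, s.2.1 <= s'.2.1, s'.2.2 <= s.2.2 &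
   (s'.1.2 - s'.1.1) + (s'.2.2 - s'.2.1) = ((s.1.2 - s.1.1) + (s.2.2 - s.2.1)) / 2].
(* The implication stands under the existential so that choice gives a map defined on all
   rectangles, ready to be iterated. *)
have badstep s : exists s', bad s -> bad s' /\ half s s'.
  case: (pselect (bad s)) => [|nb]; last by exists s.
  move: s => [[a b] [c d]] bs; case: (bs) => /= -[xa ab bx] [yc cd dy] nP.
  apply: contrapT => none; apply: nP.
  have quarter a' b' c' d' : a <= a' -> a' <= b' -> b' <= b -> c <= c' ->
     c' <= d' -> d' <= d -> (b' - a') + (d' - c') = ((b - a) + (d - c)) / 2 ->
     P a' b' c' d'.
    move=> h1 h2 h3 h4 h5 h6 h7; apply: contrapT => nP'; apply: none.
    exists ((a', b'), (c', d')) => _; split; split => //=; split; lra.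
  by apply: step => //; apply: quarter; lra.
have [f Hf] := choice badstep.
pose s n := iter n f ((x1, x2), (y1, y2)).
have bads n : bad (s n).
  elim: n => [|n IHn]; first by split=> //=; split.
  exact: (Hf _ IHn).1.
have halfs n : half (s n) (s n.+1) by exact: (Hf _ (bads n)).2.
have [p Hp] : exists p, forall n, (s n).1.1 <= p <= (s n).1.2.
  apply: nested_intervals => n; first by case: (halfs n).
    by case: (halfs n).
  by case: (bads n) => -[].
have [q Hq] : exists q, forall n, (s n).2.1 <= q <= (s n).2.2.
  apply: nested_intervals => n; first by case: (halfs n).
    by case: (halfs n).
  by case: (bads n) => _ -[].
have [e e0 He] := small p q (Hp 0%N) (Hq 0%N).
pose L := (x2 - x1) + (y2 - y1).
have size_s n : ((s n).1.2 - (s n).1.1) + ((s n).2.2 - (s n).2.1) = L / 2 ^+ n.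
  elim: n => [|n IHn]; first by rewrite expr0 divr1.
  by case: (halfs n) => _ _ _ _ ->; rewrite IHn exprSr invfM mulrA.
(* Take for [n] the successor of the integer part of [L / e] and use [n < 2 ^+ n]. *)
have [n Hn] : exists n, L / 2 ^+ n < e.
  exists (Num.truncn (L / e)).+1.
  have := truncnS_gt (L / e); rewrite !ltr_pdivrMr ?exprn_gt0// => h.
  have h2 : ((Num.truncn (L / e)).+1%:R : R) < 2 ^+ (Num.truncn (L / e)).+1.
    by rewrite -natrX ltr_nat ltn_expl.
  by rewrite mulrC (lt_trans h)// ltr_pM2r.
case: (bads n) => -[h1 h2 h3] [h4 h5 h6]; apply.
by apply: He => //; rewrite size_s.
Qed.

End Bisection.

(** * The modulus *)

Section Modulus.
Set Implicit Arguments.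
Unset Strict Implicit.
Variable R : realType.
Local Notation Re := complex.Re.
Local Notation Im := complex.Im.
Implicit Types (z u : R[i]) (F G : R[i] -> R[i]).

(** The norm of [R[i]] takes its values in [R[i]]; through this identity its properties pass to the
    real-valued [cmod]. *)
Lemma cmodE z : (cmod z)%:C = `|z|.
Proof. by case: z. Qed.

Lemma cmodM z u : cmod (z * u) = cmod z * cmod u.
Proof. by apply: complexI; rewrite rmorphM /= !cmodE normrM. Qed.

Lemma cmodV z : cmod z^-1 = (cmod z)^-1.
Proof. by apply: complexI; rewrite fmorphV /= !cmodE normfV. Qed.

Lemma cmodX z n : cmod (z ^+ n) = cmod z ^+ n.
Proof. by apply: complexI; rewrite rmorphXn /= !cmodE normrX. Qed.

Lemma cmodN z : cmod (- z) = cmod z.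
Proof. by apply: complexI; rewrite !cmodE normrN. Qed.

Lemma cmodBC z u : cmod (z - u) = cmod (u - z).
Proof. by rewrite -cmodN opprB. Qed.

Lemma cmod0 : cmod (0 : R[i]) = 0.
Proof. by apply: complexI; rewrite cmodE normr0. Qed.

Lemma cmod1 : cmod (1 : R[i]) = 1.
Proof. by apply: complexI; rewrite cmodE normr1. Qed.

Lemma cmodD z u : cmod (z + u) <= cmod z + cmod u.
Proof. by rewrite -lecR rmorphD /= !cmodE ler_normD. Qed.

Lemma cmodB z u : cmod (z - u) <= cmod z + cmod u.
Proof. by rewrite -(cmodN u) cmodD. Qed.

Lemma cmod_ge0 z : 0 <= cmod z.
Proof. by case: z => x y; exact: sqrtr_ge0. Qed.

Lemma cmod_gt0 z : (0 < cmod z) = (z != 0).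
Proof. by rewrite -ltcR cmodE normr_gt0. Qed.

Lemma cmod_eq0 z : (cmod z == 0) = (z == 0).
Proof. by rewrite -(inj_eq (@complexI _)) cmodE normr_eq0. Qed.

Lemma cmod_real (x : R) : cmod x%:C = `|x|.
Proof. by rewrite /= expr0n addr0 sqrtr_sqr. Qed.

Lemma normRe_le z : `|Re z| <= cmod z.
Proof.
case: z => x y /=; rewrite -sqrtr_sqr ler_sqrt ?addr_ge0 ?sqr_ge0//.
by rewrite lerDl sqr_ge0.
Qed.

Lemma normIm_le z : `|Im z| <= cmod z.
Proof.
case: z => x y /=; rewrite -sqrtr_sqr ler_sqrt ?addr_ge0 ?sqr_ge0//.
by rewrite lerDr sqr_ge0.
Qed.

Lemma cmod_le z : cmod z <= `|Re z| + `|Im z|.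
Proof.
case: z => x y /=; rewrite -[leRHS]ger0_norm ?addr_ge0//.
rewrite -sqrtr_sqr ler_sqrt ?sqr_ge0// sqrrD !real_normK ?num_real//.
by rewrite lerD2r lerDl mulrn_wge0// mulr_ge0.
Qed.

(** A positive element of [R[i]] is real, so the tolerances of [ctsP] can be exchanged with elements
    of [R]. *)
Lemma ctsRP F z : cts F z <-> forall e : R, 0 < e ->
  exists2 d : R, 0 < d & forall t, cmod (z - t) < d -> cmod (F z - F t) < e.
Proof.
split=> [/ctsP cF e e0|H].
  have [|d d0 hd] := cF e%:C; first by rewrite ltcR.
  have dR : d \is Num.real by exact: gtr0_real.
  exists (Re d); first by rewrite -ltcR RRe_real.
  move=> t; rewrite -ltcR cmodE RRe_real// => /hd.
  by rewrite -cmodE ltcR.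
apply/ctsP => e e0; have eR : e \is Num.real by exact: gtr0_real.
have [|d d0 hd] := H (Re e); first by rewrite -ltcR RRe_real.
exists d%:C; first by rewrite ltcR.
move=> t; rewrite -cmodE ltcR => /hd.
by rewrite -cmodE -ltcR RRe_real.
Qed.

Lemma cdiffRP F z : cdiff F z <-> exists D : R[i], forall e : R, 0 < e ->
  exists2 d : R, 0 < d & forall h, h != 0 -> cmod h < d ->
    cmod ((F (z + h) - F z) / h - D) < e.
Proof.
split=> [/cdiffP[D HD]|[D HD]].
  exists D => e e0; have [|d d0 hd] := HD e%:C; first by rewrite ltcR.
  have dR : d \is Num.real by exact: gtr0_real.
  exists (Re d); first by rewrite -ltcR RRe_real.
  move=> h h0; rewrite -ltcR cmodE RRe_real// => /(hd _ h0).
  by rewrite -cmodE ltcR.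
apply/cdiffP; exists D => e e0; have eR : e \is Num.real by exact: gtr0_real.
have [|d d0 hd] := HD (Re e); first by rewrite -ltcR RRe_real.
exists d%:C; first by rewrite ltcR.
move=> h h0; rewrite -cmodE ltcR => /(hd _ h0).
by rewrite -cmodE -ltcR RRe_real.
Qed.

Lemma entireP F : entire F <-> forall z, cdiff F z.
Proof.
split=> [eF z|dF z].
  apply/cdiffRP; have [D HD] := eF z; exists D => e e0.
  have [d [d0 hd]] := HD e e0; exists d => // h h0; apply: hd.
  by rewrite cmod_gt0.
have /cdiffRP[D HD] := dF z; exists D => e e0.
have [d d0 hd] := HD e e0; exists d; split=> // h; rewrite cmod_gt0.
exact: hd.
Qed.

End Modulus.

(** * Contour integrals along rectangles *)

Section Contour.
Set Implicit Arguments.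
Unset Strict Implicit.
Import numFieldNormedType.Exports.
Local Open Scope classical_set_scope.
Variable R : realType.
Implicit Types (a b c d x y t B : R) (z k : R[i]) (F G : R[i] -> R[i])
  (f g : R -> R[i]).
Local Notation Re := complex.Re.
Local Notation Im := complex.Im.

Definition cI x y f : R[i] :=
  Complex (Rint x y (fun t => Re (f t))) (Rint x y (fun t => Im (f t))).

Definition cctson x y f :=
  ctson x y (fun t => Re (f t)) /\ ctson x y (fun t => Im (f t)).

(** Meant for [h] the real or imaginary part and [l] the parametrisation of a side of a rectangle by
    arc length. *)
Lemma ctson_comp (h : R[i] -> R) x y (l : R -> R[i]) F :
  (forall u v, `|h u - h v| <= cmod (u - v)) ->
  (forall s t, cmod (l s - l t) = `|s - t|) ->
  (forall t, x <= t <= y -> cts F (l t)) -> ctson x y (fun t => h (F (l t))).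
Proof.
move=> h_lip l_isom cF t xty; apply/cvgrPdist_lt => e e0.
have /ctsRP/(_ e e0)[del del0 hdel] := cF t xty.
exists del => //= s; rewrite /ball_ /= -l_isom => /hdel; apply: le_lt_trans.
exact: h_lip.
Qed.

Lemma cctson_comp x y (l : R -> R[i]) F :
  (forall s t, cmod (l s - l t) = `|s - t|) ->
  (forall t, x <= t <= y -> cts F (l t)) -> cctson x y (fun t => F (l t)).
Proof.
move=> l_isom cF; split; apply: ctson_comp cF => // -[u1 u2] [v1 v2] /=.
  exact: (normRe_le (Complex (u1 - v1) (u2 - v2))).
exact: (normIm_le (Complex (u1 - v1) (u2 - v2))).
Qed.

Lemma horizontal_isometry c s t : cmod (Complex s c - Complex t c) = `|s - t|.
Proof. by rewrite -[_ - _]/(Complex (s - t) (c - c)) subrr cmod_real. Qed.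

Lemma vertical_isometry a s t : cmod (Complex a s - Complex a t) = `|s - t|.
Proof.
by rewrite -[_ - _]/(Complex (a - a) (s - t)) /cmod subrr expr0n add0r sqrtr_sqr.
Qed.

Lemma eq_cI x y f g : (forall t, x <= t <= y -> f t = g t) -> cI x y f = cI x y g.
Proof. by move=> fg; congr Complex; apply: eq_Rint => t /fg ->. Qed.

Lemma cI_cst x y k : x <= y -> cI x y (fun=> k) = (y - x)%:C * k.
Proof. by case: k => k1 k2 xy; rewrite /cI !Rint_cst//; simpc; rewrite ![_ * (y - x)]mulrC. Qed.

Lemma cID x y f g : cctson x y f -> cctson x y g ->
  cI x y (fun t => f t + g t) = cI x y f + cI x y g.
Proof.
move=> [cf1 cf2] [cg1 cg2]; rewrite /cI; simpc; rewrite -!RintD//.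
by congr Complex; apply: eq_Rint => t _; case: (f t) => ? ?; case: (g t).
Qed.

Lemma cIZ x y k f : cctson x y f -> cI x y (fun t => k * f t) = k * cI x y f.
Proof.
case: k => k1 k2 [cf1 cf2]; rewrite /cI; simpc.
have cZ c u : ctson x y u -> ctson x y (fun t => c * u t).
  by move=> cu t xty; apply: continuousM; [exact: cst_continuous|exact: cu].
rewrite -mulNr -!RintZ// -!RintD; try exact: cZ.
by congr Complex; apply: eq_Rint => t _; case: (f t) => ? ? /=; rewrite ?mulNr.
Qed.

Lemma cI_chasles x m y f : x <= m <= y -> cctson x y f ->
  cI x y f = cI x m f + cI m y f.
Proof.
by move=> xmy [cf1 cf2]; rewrite /cI; simpc; congr Complex; exact: Rint_chasles.
Qed.

Lemma cI_bound x y f B : x <= y -> cctson x y f ->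
  (forall t, x <= t <= y -> cmod (f t) <= B) -> cmod (cI x y f) <= 2 * B * (y - x).
Proof.
move=> xy [cf1 cf2] fB; apply: (le_trans (cmod_le _)) => /=.
rewrite -mulrA mulr_natl mulr2n; apply: lerD; apply: Rint_bound => // t xty.
  by apply: le_trans (fB t xty); exact: normRe_le.
by apply: le_trans (fB t xty); exact: normIm_le.
Qed.

Definition rect a b c d z := (a <= Re z <= b) /\ (c <= Im z <= d).

Definition bdry a b c d z :=
  rect a b c d z /\ (Re z = a \/ Re z = b \/ Im z = c \/ Im z = d).

(** The counterclockwise integral over the boundary: [dz = dt] on horizontal sides and [dz = i dt]
    on vertical ones. *)
Definition contour a b c d F : R[i] :=
  cI a b (fun t => F (Complex t c)) - cI a b (fun t => F (Complex t d)) +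
  'i%C * (cI c d (fun t => F (Complex b t)) - cI c d (fun t => F (Complex a t))).

Section Rectangle.
Variables a b c d : R.
Hypotheses (ab : a <= b) (cd : c <= d).

Lemma bdry_bottom t : a <= t <= b -> bdry a b c d (Complex t c).
Proof. by move=> h; split; [split=> //=; rewrite lexx|right; right; left]. Qed.

Lemma bdry_top t : a <= t <= b -> bdry a b c d (Complex t d).
Proof. by move=> h; split; [split=> //=; rewrite lexx andbT|right; right; right]. Qed.

Lemma bdry_left t : c <= t <= d -> bdry a b c d (Complex a t).
Proof. by move=> h; split; [split=> //=; rewrite lexx|left]. Qed.

Lemma bdry_right t : c <= t <= d -> bdry a b c d (Complex b t).
Proof. by move=> h; split; [split=> //=; rewrite lexx andbT|right; left]. Qed.

Lemma bdry_cctson F : (forall z, bdry a b c d z -> cts F z) ->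
  [/\ cctson a b (fun t => F (Complex t c)), cctson a b (fun t => F (Complex t d)),
      cctson c d (fun t => F (Complex b t)) & cctson c d (fun t => F (Complex a t))].
Proof.
move=> cF; split; apply: cctson_comp; do ?[exact: horizontal_isometry|exact: vertical_isometry];
  move=> t ht; apply: cF.
- exact: bdry_bottom.
- exact: bdry_top.
- exact: bdry_right.
- exact: bdry_left.
Qed.

Lemma eq_contour F G : (forall z, bdry a b c d z -> F z = G z) ->
  contour a b c d F = contour a b c d G.
Proof.
move=> FG; congr (_ - _ + _ * (_ - _)); apply: eq_cI => t ht; apply: FG.
- exact: bdry_bottom.
- exact: bdry_top.
- exact: bdry_right.
- exact: bdry_left.
Qed.

Lemma contour_cst k : contour a b c d (fun=> k) = 0.
Proof. by rewrite /contour !subrr mulr0 addr0. Qed.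

(** On opposite sides the identity differs by a constant. The two resulting terms,
    [i (b - a) (c - d)] and [i (d - c) (b - a)], cancel. *)
Lemma contour_id : contour a b c d id = 0.
Proof.
have [F1 F2 F3 F4] := @bdry_cctson id (fun z _ => @cts_id _ z).
rewrite /contour.
rewrite (@eq_cI a b _ (fun t => Complex t d + Complex 0 (c - d))); last first.
  by move=> t _; simpc; rewrite subrKC.
rewrite (@eq_cI c d (fun t => Complex b t) (fun t => Complex a t + (b - a)%:C)); last first.
  by move=> t _; simpc; rewrite subrKC.
rewrite !cID//; try by split=> t _; exact: cst_continuous.
rewrite !cI_cst//; simpc.
by congr Complex; ring.
Qed.

Lemma contourD F G : (forall z, bdry a b c d z -> cts F z) ->
  (forall z, bdry a b c d z -> cts G z) ->
  contour a b c d (fun z => F z + G z) = contour a b c d F + contour a b c d G.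
Proof.
move=> /bdry_cctson[F1 F2 F3 F4] /bdry_cctson[G1 G2 G3 G4].
by rewrite /contour !cID//; ring.
Qed.

Lemma contourZ k F : (forall z, bdry a b c d z -> cts F z) ->
  contour a b c d (fun z => k * F z) = k * contour a b c d F.
Proof. by move=> /bdry_cctson[F1 F2 F3 F4]; rewrite /contour !cIZ//; ring. Qed.

(** The bound is [2 * B] times the perimeter, with the 2 of [cI_bound]. *)
Lemma contour_bound F B : (forall z, bdry a b c d z -> cts F z) ->
  (forall z, bdry a b c d z -> cmod (F z) <= B) ->
  cmod (contour a b c d F) <= 4 * B * ((b - a) + (d - c)).
Proof.
move=> /bdry_cctson[F1 F2 F3 F4] FB.
apply: (le_trans (cmodD _ _)); rewrite cmodM.
have -> : cmod ('i%C : R[i]) = 1 by rewrite /= expr0n expr1n add0r sqrtr1.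
rewrite mul1r.
apply: le_trans (lerD (cmodB _ _) (cmodB _ _)) _.
have h1 := cI_bound ab F1 (fun t ht => FB _ (bdry_bottom ht)).
have h2 := cI_bound ab F2 (fun t ht => FB _ (bdry_top ht)).
have h3 := cI_bound cd F3 (fun t ht => FB _ (bdry_right ht)).
have h4 := cI_bound cd F4 (fun t ht => FB _ (bdry_left ht)).
lra.
Qed.

Lemma contour_splitx m F : a <= m <= b -> (forall z, bdry a b c d z -> cts F z) ->
  contour a b c d F = contour a m c d F + contour m b c d F.
Proof.
move=> amb /bdry_cctson[F1 F2 _ _].
by rewrite /contour (cI_chasles amb F1) (cI_chasles amb F2); ring.
Qed.

Lemma contour_splity m F : c <= m <= d -> (forall z, bdry a b c d z -> cts F z) ->
  contour a b c d F = contour a b c m F + contour a b m d F.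
Proof.
move=> cmd /bdry_cctson[_ _ F3 F4].
by rewrite /contour (cI_chasles cmd F3) (cI_chasles cmd F4); ring.
Qed.

End Rectangle.
End Contour.

(** * Goursat's theorem *)

Section Goursat.
Set Implicit Arguments.
Unset Strict Implicit.
Variable R : realType.
Implicit Types (a b c d x y t B : R) (z k : R[i]) (F G : R[i] -> R[i]).
Local Notation Re := complex.Re.
Local Notation Im := complex.Im.

Lemma contour_quarters a b c d F m n : a <= m <= b -> c <= n <= d ->
  (forall z, rect a b c d z -> cts F z) ->
  contour a b c d F = contour a m c n F + contour m b c n F +
                      (contour a m n d F + contour m b n d F).
Proof.
move=> /andP[am mb] /andP[cn nd] cF; have ab := le_trans am mb.
have cF' a' b' c' d' : a <= a' -> b' <= b -> c <= c' -> d' <= d ->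
    forall z, bdry a' b' c' d' z -> cts F z.
  by move=> ? ? ? ? z [[/andP[? ?] /andP[? ?]] _]; apply: cF; split; lra.
rewrite (@contour_splity _ a b c d ab (le_trans cn nd) n) ?cn//; last exact: cF'.
rewrite (@contour_splitx _ a b c n ab cn m) ?am//; last exact: cF'.
by rewrite (@contour_splitx _ a b n d ab nd m) ?am//; apply: cF'.
Qed.

(** The bound by [e] times the squared half perimeter survives bisection, since each quarter carries
    a fourth of it. Near a point, [F] is an affine function, whose contour integral is zero, plus an
    error small compared with the distance to that point. *)
Lemma goursat a b c d F : a <= b -> c <= d ->
  (forall z, rect a b c d z -> cdiff F z) -> contour a b c d F = 0.
Proof.
move=> ab cd dF.
suff small e : 0 < e -> cmod (contour a b c d F) <= e * ((b - a) + (d - c)) ^+ 2.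
  apply/eqP; rewrite -cmod_eq0 eq_le cmod_ge0 andbT leNgt; apply/negP.
  set M := cmod _ in small *; move=> M0; set S := (_ + _) ^+ 2 in small.
  have S0 : 0 <= S by exact: sqr_ge0.
  (* This value of [e] brings the bound [e * S] below [M / 2]. *)
  have e0 : 0 < M / (2 * (S + 1)) by rewrite divr_gt0// mulr_gt0// ltr_pwDr.
  have := small _ e0; rewrite mulrAC ler_pdivlMr; last by rewrite mulr_gt0// ltr_pwDr.
  nra.
move=> e0.
apply: (@rectangle_bisection _ (fun a b c d =>
  cmod (contour a b c d F) <= e * ((b - a) + (d - c)) ^+ 2)) => //.
  move=> a' b' c' d' h1 h2 h3 h4 h5 h6 q1 q2 q3 q4.
  rewrite (@contour_quarters a' b' c' d' F ((a' + b') / 2) ((c' + d') / 2)); first last.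
  - move=> z [/andP[? ?] /andP[? ?]]; apply/cdiff_cts/dF.
    by clear q1 q2 q3 q4; split; lra.
  - by clear q1 q2 q3 q4; lra.
  - by clear q1 q2 q3 q4; lra.
  apply: le_trans (cmodD _ _) _.
  apply: le_trans (lerD (cmodD _ _) (cmodD _ _)) _.
  apply: le_trans (lerD (lerD q1 q2) (lerD q3 q4)) _.
  by rewrite le_eqVlt; apply/orP; left; apply/eqP; field.
move=> p q hp hq; set z := Complex p q.
have /cdiffRP[D HD] : cdiff F z by apply: dF; split.
(* The divisor 4 absorbs the constant of [contour_bound]. *)
have e40 : 0 < e / 4 by lra.
have [del del0 hdel] := HD _ e40.
exists del => // a' b' c' d' h1 h2 h3 h4 h5 h6 S_lt.
set S := (_ + _) in S_lt *.
pose G u := F u - (F z + D * (u - z)).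
have near_z u : rect a' b' c' d' u -> cmod (u - z) <= S.
  move: h2 h5 => /andP[? ?] /andP[? ?] [/andP[? ?] /andP[? ?]].
  apply: le_trans (cmod_le _) _; apply: lerD;
    rewrite raddfB ler_norml /=; lra.
have GS u : bdry a' b' c' d' u -> cmod (G u) <= e / 4 * S.
  move=> [hu _]; apply: (@le_trans _ _ (e / 4 * cmod (u - z))); last first.
    by rewrite ler_pM2l// near_z.
  have [->|uz] := eqVneq u z.
    by rewrite /G subrr mulr0 addr0 subrr cmod0 mulr0.
  have h0 : u - z != 0 by rewrite subr_eq0.
  have := hdel _ h0 (le_lt_trans (near_z _ hu) S_lt).
  rewrite [z + _]addrC subrK => hh.
  have -> : G u = ((F u - F z) / (u - z) - D) * (u - z).
    by rewrite /G; field.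
  by rewrite cmodM ler_wpM2r ?cmod_ge0// ltW.
have cG u : bdry a' b' c' d' u -> cts G u.
  move=> [[/andP[? ?] /andP[? ?]] _]; apply: cdiff_cts; apply: cdiffB.
    by apply: dF; split; lra.
  apply: cdiffD; first exact: cdiff_cst.
  apply: cdiffM; first exact: cdiff_cst.
  by apply: cdiffB; [exact: cdiff_id|exact: cdiff_cst].
have [a'b' c'd'] : a' <= b' /\ c' <= d' by split; lra.
have cid u : bdry a' b' c' d' u -> cts id u by move=> _; exact: cts_id.
have -> : contour a' b' c' d' F = contour a' b' c' d' G.
  transitivity (contour a' b' c' d' (fun u => G u + (D * u + (F z - D * z)))).
    by apply: eq_contour => // u _; rewrite /G; ring.
  have cDu u : cts (fun u => D * u) u by apply: ctsM; [exact: cts_cst|exact: cts_id].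
  have ck u : cts (fun=> F z - D * z) u by exact: cts_cst.
  rewrite (@contourD _ _ _ _ _ a'b' c'd' G (fun u => D * u + (F z - D * z)) cG).
    rewrite (@contourD _ _ _ _ _ a'b' c'd' (fun u => D * u) (fun=> F z - D * z)).
    - by rewrite (contourZ a'b' c'd' D cid) contour_id// contour_cst mulr0 !addr0.
    - by move=> u _; exact: cDu.
    - by move=> u _; exact: ck.
  by move=> u _; apply: ctsD; [exact: cDu|exact: ck].
apply: le_trans (contour_bound _ _ cG GS) _ => //.
by rewrite -/S le_eqVlt; apply/orP; left; apply/eqP; field.
Qed.

End Goursat.

(** * Isolated singularities *)

Section Cauchy.
Set Implicit Arguments.
Unset Strict Implicit.
Variable R : realType.
Implicit Types (a b c d x y t B : R) (z k : R[i]) (F G : R[i] -> R[i]).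
Local Notation Re := complex.Re.
Local Notation Im := complex.Im.

(** Cutting along the sides of the inner rectangle leaves four outer pieces that miss [z], so
    Goursat's theorem makes each of them contribute zero. *)
Lemma contour_shrink a b c d a' b' c' d' z F :
  a <= a' -> a' < Re z -> Re z < b' -> b' <= b ->
  c <= c' -> c' < Im z -> Im z < d' -> d' <= d ->
  (forall u, u != z -> cdiff F u) -> contour a b c d F = contour a' b' c' d' F.
Proof.
move=> h1 h2 h3 h4 h5 h6 h7 h8 dF.
have off a0 b0 c0 d0 u : rect a0 b0 c0 d0 u ->
    (b0 < Re z) || (Re z < a0) || (d0 < Im z) || (Im z < c0) -> cdiff F u.
  move=> [/andP[? ?] /andP[? ?]] h; apply: dF; apply/eqP => uz.
  by subst u; move: h => /orP[/orP[/orP[]|]|]; lra.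
have on a0 b0 c0 d0 u : a0 < Re z < b0 -> c0 < Im z < d0 -> bdry a0 b0 c0 d0 u ->
    cts F u.
  move=> /andP[? ?] /andP[? ?] [_ hu]; apply/cdiff_cts/dF; apply/eqP => uz.
  by subst u; move: hu => [|[|[|]]]; lra.
have [ab cd a'b' a'b b'b] : [/\ a <= b, c <= d, a' <= b', a' <= b & b' <= b].
  by split; lra.
have [aa' cc' c'd c'd' d'd] : [/\ a <= a', c <= c', c' <= d, c' <= d' & d' <= d].
  by split; lra.
rewrite (@contour_splitx _ a b c d ab cd a'); first last.
- by move=> u; apply: on; lra.
- by apply/andP.
rewrite (goursat aa' cd); last by move=> u /off; apply; lra.
rewrite (@contour_splitx _ a' b c d a'b cd b'); first last.
- by move=> u; apply: on; lra.
- by apply/andP.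
rewrite (goursat b'b cd); last by move=> u /off; apply; lra.
rewrite (@contour_splity _ a' b' c d a'b' cd c'); first last.
- by move=> u; apply: on; lra.
- by apply/andP.
rewrite (goursat a'b' cc'); last by move=> u /off; apply; lra.
rewrite (@contour_splity _ a' b' c' d a'b' c'd d'); first last.
- by move=> u; apply: on; lra.
- by apply/andP.
rewrite (goursat a'b' d'd); last by move=> u /off; apply; lra.
by rewrite !add0r !addr0.
Qed.

(** The quotient is differentiable away from [z] and bounded near [z]. Shrinking the contour to a
    small square around [z] therefore makes the integral arbitrarily small, and no differentiability
    of the quotient at [z] has to be established. *)
Lemma contour_difference_quotient a b c d z F : a < Re z < b -> c < Im z < d ->
  (forall u, cdiff F u) -> contour a b c d (fun u => (F u - F z) / (u - z)) = 0.
Proof.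
move=> /andP[az zb] /andP[cz zd] dF; set q := fun u => _.
have dq u : u != z -> cdiff q u.
  move=> uz; have duz : cdiff (fun u => u - z) u.
    by apply: cdiffB; [exact: cdiff_id|exact: cdiff_cst].
  apply: cdiffM; first by apply: cdiffB; [exact: dF|exact: cdiff_cst].
  by apply: cdiffV => //; rewrite subr_eq0.
have /cdiffRP[D HD] := dF z.
have [del del0 hdel] := HD 1 ltr01.
have qB u : u != z -> cmod (u - z) < del -> cmod (q u) <= cmod D + 1.
  move=> uz; rewrite -subr_eq0 in uz; move=> /(hdel _ uz).
  rewrite [z + _]addrC subrK => h.
  rewrite -[q u](subrK D) [leRHS]addrC; apply: le_trans (cmodD _ _) _.
  by rewrite lerD2r ltW.
(* A square of half side at most [e0] stays in the rectangle. Its points are within [2 * e0 < del]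
   of [z], as [cmod] is at most the sum of the absolute values of the coordinates. *)
pose e0 := Num.min (del / 3) (Num.min (Num.min (Re z - a) (b - Re z))
                                      (Num.min (Im z - c) (d - Im z))).
have e00 : 0 < e0 by rewrite !lt_min !subr_gt0 az zb cz zd divr_gt0.
have D0 := cmod_ge0 D.
(* The square has half perimeter [4 * e]; with the factor 4 of [contour_bound] this gives 16. *)
have small e : 0 < e -> e <= e0 -> cmod (contour a b c d q) <= 16 * (cmod D + 1) * e.
  move=> ep; rewrite !le_min => /andP[h1 /andP[/andP[h2 h3] /andP[h4 h5]]].
  rewrite (@contour_shrink a b c d (Re z - e) (Re z + e) (Im z - e) (Im z + e) z _) //;
    do ?by clear -h1 h2 h3 h4 h5 ep; lra.
  have off u : bdry (Re z - e) (Re z + e) (Im z - e) (Im z + e) u -> u != z.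
    move=> [_ h]; apply/eqP => uz; subst u; clear - h ep.
    by move: h => [|[|[|]]]; lra.
  have := @contour_bound _ (Re z - e) (Re z + e) (Im z - e) (Im z + e) _ _ q
    (cmod D + 1).
  have -> : 4 * (cmod D + 1) * (Re z + e - (Re z - e) + (Im z + e - (Im z - e)))
     = 16 * (cmod D + 1) * e by ring.
  apply.
  - by clear - ep; lra.
  - by clear - ep; lra.
  - by move=> u /off /dq /cdiff_cts.
  move=> u hu; apply: qB; first exact: off.
  case: hu => -[/andP[g1 g2] /andP[g3 g4]] _.
  apply: le_lt_trans (cmod_le _) _; apply: (@le_lt_trans _ _ (e + e)).
    by apply: lerD; rewrite raddfB ler_norml /=; clear - g1 g2 g3 g4; lra.
  by clear - h1 ep; lra.
apply/eqP; rewrite -cmod_eq0 eq_le cmod_ge0 andbT leNgt; apply/negP => M0.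
set M := cmod (contour _ _ _ _ _) in small M0.
have K0 : 0 < 32 * (cmod D + 1) by rewrite mulr_gt0// ltr_wpDl.
(* Chosen so that the bound at [r] is [M / 2]. *)
set r := M / (32 * (cmod D + 1)).
have : M <= 16 * (cmod D + 1) * Num.min e0 r.
  by apply: small; [rewrite lt_min e00 divr_gt0|rewrite ge_min lexx].
apply/negP; rewrite -ltNge; apply: (@le_lt_trans _ _ (16 * (cmod D + 1) * r)).
  by rewrite ler_pM2l ?ge_min ?lexx ?orbT// mulr_gt0// ltr_wpDl.
rewrite /r mulrCA -[ltRHS]mulr1 ltr_pM2l// ltr_pdivrMr// mul1r.
by rewrite ltr_pM2r ?ltr_nat// ltr_wpDl.
Qed.

(** Compactness by bisection: bounds on the quarters combine into their maximum, and continuity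
    gives a bound near each point. *)
Lemma rect_bounded a b c d F : a <= b -> c <= d ->
  (forall z, rect a b c d z -> cts F z) ->
  exists B, forall z, rect a b c d z -> cmod (F z) <= B.
Proof.
move=> ab cd cF.
apply: (@rectangle_bisection _ (fun a b c d =>
  exists B, forall z, rect a b c d z -> cmod (F z) <= B)) => //.
  move=> a' b' c' d' _ _ _ _ _ _ [B1 h1] [B2 h2] [B3 h3] [B4 h4].
  exists (Num.max (Num.max B1 B2) (Num.max B3 B4)) => z [/andP[? ?] /andP[? ?]].
  rewrite !le_max; case: (lerP (Re z) ((a' + b') / 2)) => hx;
    case: (lerP (Im z) ((c' + d') / 2)) => hy.
  - by rewrite h1//; split; apply/andP; rewrite ?(ltW hx) ?(ltW hy).
  - by rewrite h3 ?orbT//; split; apply/andP; rewrite ?(ltW hx) ?(ltW hy).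
  - by rewrite h2 ?orbT//; split; apply/andP; rewrite ?(ltW hx) ?(ltW hy).
  - by rewrite h4 ?orbT//; split; apply/andP; rewrite ?(ltW hx) ?(ltW hy).
move=> p q hp hq; have /ctsRP/(_ 1 ltr01)[del del0 hdel] : cts F (Complex p q).
  by apply: cF; split.
exists del => // a' b' c' d' _ /andP[g1 g2] _ _ /andP[g3 g4] _ S_lt.
exists (cmod (F (Complex p q)) + 1) => z [/andP[g5 g6] /andP[g7 g8]].
have : cmod (F (Complex p q) - F z) < 1.
  apply: hdel; apply: le_lt_trans (cmod_le _) _; apply: le_lt_trans S_lt.
  by apply: lerD; rewrite raddfB ler_norml /=; clear - g1 g2 g3 g4 g5 g6 g7 g8; lra.
move=> h; rewrite -{1}[F z](subKr (F (Complex p q))).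
by apply: le_trans (cmodB _ _) _; rewrite lerD2l ltW.
Qed.

End Cauchy.

(** * Cauchy's formula on a square and lowest order terms *)

Section Germ.
Set Implicit Arguments.
Unset Strict Implicit.
Variable R : realType.
Implicit Types (a b c d x y t B : R) (z k : R[i]) (F G : R[i] -> R[i]) (m n : nat).
Local Notation Re := complex.Re.
Local Notation Im := complex.Im.

Let sq := @bdry R (-1) 1 (-1) 1.

Let m1_le1 : (-1 : R) <= 1. Proof. by lra. Qed.

Lemma square_cmod_ge1 u : sq u -> 1 <= cmod u.
Proof.
by move=> [_ [|[|[|]]] h];
  [have := normRe_le u|have := normRe_le u|have := normIm_le u|have := normIm_le u];
  rewrite h ?normrN normr1.
Qed.

Lemma square_dist u z : sq u -> cmod z <= 1 / 2 -> 1 / 2 <= cmod (u - z).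
Proof.
move=> /square_cmod_ge1 u1 z2; have := cmodD (u - z) z; rewrite subrK; lra.
Qed.

Lemma square_neq0 u : sq u -> u != 0.
Proof. by move/square_cmod_ge1 => ?; rewrite -cmod_gt0 (lt_le_trans ltr01). Qed.

Lemma square_subr_neq0 u z : sq u -> cmod z <= 1 / 2 -> u - z != 0.
Proof. by move=> su /(square_dist su) h; rewrite -cmod_gt0 (lt_le_trans _ h). Qed.

(** Up to the factor [2 pi i], for entire [F] and [z] inside the square, this is the Taylor series
    of [F] at the origin, stripped of its terms of degree below [m] and divided by [z ^+ m]; at
    [z = 0] it is the coefficient of degree [m]. *)
Definition cauchy F m z : R[i] :=
  contour (-1) 1 (-1) 1 (fun u => F u / (u ^+ m * (u - z))).

Lemma cdiff_cauchy_kernel F m z u : cdiff F u -> sq u -> cmod z <= 1 / 2 ->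
  cdiff (fun u => F u / (u ^+ m * (u - z))) u.
Proof.
move=> dF su z2; apply: cdiffM => //; apply: cdiffV.
  exact: mulf_neq0 (expf_neq0 _ (square_neq0 su)) (square_subr_neq0 su z2).
apply: cdiffM; first by apply: cdiffX; exact: cdiff_id.
by apply: cdiffB; [exact: cdiff_id|exact: cdiff_cst].
Qed.

Lemma cmod0_le2 : cmod (0 : R[i]) <= 1 / 2.
Proof. by rewrite cmod0 divr_ge0. Qed.
Hint Resolve cmod0_le2 : core.

(** Integrated form of [1 / (u - z) = 1 / u + z / (u * (u - z))]. *)
Lemma cauchy_step F m z : (forall u, cdiff F u) -> cmod z <= 1 / 2 ->
  cauchy F m z = cauchy F m 0 + z * cauchy F m.+1 z.
Proof.
move=> dF z2; have cK n (y : R[i]) : cmod y <= 1 / 2 -> forall u, sq u ->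
    cts (fun u => F u / (u ^+ n * (u - y))) u.
  by move=> hy u su; apply/cdiff_cts/cdiff_cauchy_kernel.
have cK0 := cK m 0 cmod0_le2; have cK1 := cK m.+1 z z2.
rewrite /cauchy -(contourZ m1_le1 m1_le1 z cK1).
rewrite -(@contourD _ _ _ _ _ m1_le1 m1_le1 _ _ cK0); last first.
  by move=> u su; apply: ctsM; [exact: cts_cst|exact: cK1].
apply: (eq_contour m1_le1 m1_le1) => u su; rewrite subr0 exprS.
have u0 := square_neq0 su; have uz0 := square_subr_neq0 su z2.
by field; rewrite uz0 expf_neq0 // u0.
Qed.

(** Uniformity in [m] holds because [1 <= cmod u] on the boundary of the square; the distance 1/2
    from [u] to [z] accounts for the factor 2. *)
Lemma cauchy_bounded F : (forall u, cdiff F u) ->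
  exists K, forall m z, cmod z <= 1 / 2 -> cmod (cauchy F m z) <= K.
Proof.
move=> dF; have [B HB] := rect_bounded m1_le1 m1_le1 (fun z _ => cdiff_cts (dF z)).
exists (4 * (2 * B) * ((1 - -1) + (1 - -1))) => m z z2.
apply: contour_bound => // u su; first exact/cdiff_cts/cdiff_cauchy_kernel.
have FB : cmod (F u) <= B by apply: HB; case: su.
have B0 : 0 <= B := le_trans (cmod_ge0 _) FB.
rewrite cmodM cmodV cmodM cmodX mulrC ler_pM ?invr_ge0 ?mulr_ge0 ?exprn_ge0 ?cmod_ge0//.
rewrite -[leRHS]invrK lef_pV2 ?posrE ?invr_gt0//; last first.
  by rewrite mulr_gt0 ?exprn_gt0 ?cmod_gt0 ?(square_neq0 su) ?(square_subr_neq0 su z2).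
rewrite -[leLHS]mul1r ler_pM//.
  by apply: exprn_ege1; exact: square_cmod_ge1.
by have := square_dist su z2; rewrite div1r.
Qed.

(** By [cauchy_step], the increment from 0 to [z] is [z] times a bounded quantity. *)
Lemma cts_cauchy F m : (forall u, cdiff F u) -> cts (cauchy F m) 0.
Proof.
move=> dF; have [K HK] := cauchy_bounded dF; apply/ctsRP => e e0.
have K0 : 0 <= K := le_trans (cmod_ge0 _) (HK 0%N 0 cmod0_le2).
have K10 : 0 < K + 1 by rewrite ltr_wpDl.
exists (Num.min (1 / 2) (e / (K + 1))); first by rewrite lt_min !divr_gt0.
move=> z; rewrite sub0r cmodN lt_min => /andP[/ltW z2].
rewrite ltr_pdivlMr// => ze; rewrite cmodBC (cauchy_step _ dF z2) addrC addKr cmodM.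
apply: le_lt_trans ze; rewrite ler_wpM2l ?cmod_ge0//.
by apply: le_trans (HK _ _ z2) _; rewrite lerDl.
Qed.

(** Split [F u] as [(F u - F z) + F z]; the first part integrates to zero. The integral of
    [1 / (u - z)] is left unevaluated, as it will be enough that it is nonzero. *)
Lemma cauchy_formula F z : (forall u, cdiff F u) -> cmod z <= 1 / 2 ->
  cauchy F 0 z = F z * cauchy (fun=> 1) 0 z.
Proof.
move=> dF z2; have := normRe_le z; have := normIm_le z.
rewrite !ler_norml => /andP[h1 h2] /andP[h3 h4].
have q0 : contour (-1) 1 (-1) 1 (fun u => (F u - F z) / (u - z)) = 0.
  by apply: contour_difference_quotient => //; lra.
have d1 u : cdiff (fun=> 1 : R[i]) u by exact: cdiff_cst.
rewrite /cauchy -(@contourZ _ _ _ _ _ m1_le1 m1_le1 (F z)); last first.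
  by move=> u su; apply/cdiff_cts/cdiff_cauchy_kernel.
rewrite -[RHS]add0r -[X in X + _]q0 -contourD//.
- apply: (eq_contour m1_le1 m1_le1) => u su; rewrite expr0 mul1r; ring.
- move=> u su; apply: cdiff_cts; apply: cdiffM.
    by apply: cdiffB => //; exact: cdiff_cst.
  apply: cdiffV; first exact: square_subr_neq0.
  by apply: cdiffB; [exact: cdiff_id|exact: cdiff_cst].
move=> u su; apply: ctsM; first exact: cts_cst.
exact/cdiff_cts/cdiff_cauchy_kernel.
Qed.

Lemma ReV z : Re z^-1 = Re z / (Re z ^+ 2 + Im z ^+ 2).
Proof. by case: z. Qed.

Lemma ImV z : Im z^-1 = - (Im z / (Re z ^+ 2 + Im z ^+ 2)).
Proof. by case: z. Qed.

(* Along each side of the square, [du / (u - z)] has positive imaginary part. *)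
Lemma winding_neq0 z : cmod z <= 1 / 2 -> cauchy (fun=> 1) 0 z != 0.
Proof.
move=> z2; have := normRe_le z; have := normIm_le z.
rewrite !ler_norml => /andP[h1 h2] /andP[h3 h4].
set h := fun u => 1 / (u ^+ 0 * (u - z)).
have hE u : h u = (u - z)^-1 by rewrite /h expr0 !mul1r.
have ch u : sq u -> cts h u.
  by move=> su; apply/cdiff_cts/cdiff_cauchy_kernel => //; exact: cdiff_cst.
have [[_ H1] [_ H2] [H3 _] [H4 _]] := bdry_cctson m1_le1 m1_le1 ch.
(* Here [x] is the distance from [z] to the line of a side and [y] the offset along that side. The
   constant 1/9 is the least numerator 1/2 over the largest denominator 9/2. *)
have ratio x y : 1 / 2 <= x -> x <= 3 / 2 -> -(3 / 2) <= y -> y <= 3 / 2 ->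
    1 / 9 <= x / (x ^+ 2 + y ^+ 2).
  move=> x1 x2 y1 y2; rewrite ler_pdivlMr; first by nra.
  by rewrite ltr_pwDl ?sqr_ge0// exprn_gt0//; lra.
have low (v : R -> R) : ctson (-1) 1 v -> (forall t, -1 <= t <= 1 -> 1 / 9 <= v t) ->
    0 < Rint (-1) 1 v.
  move=> cv v9; apply: (@lt_le_trans _ _ (Rint (-1) 1 (fun=> 1 / 9))).
    by rewrite Rint_cst//; lra.
  by apply: le_Rint => //; exact: ctson_cst.
have high (v : R -> R) : ctson (-1) 1 v ->
    (forall t, -1 <= t <= 1 -> v t <= - (1 / 9)) -> Rint (-1) 1 v < 0.
  move=> cv v9; apply: (@le_lt_trans _ _ (Rint (-1) 1 (fun=> - (1 / 9)))).
    by apply: le_Rint => //; exact: ctson_cst.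
  by rewrite Rint_cst//; lra.
have bottom := low _ H1; have top := high _ H2.
have right := low _ H3; have left := high _ H4.
suff : 0 < Im (cauchy (fun=> 1) 0 z).
  by apply: contraTneq => ->; rewrite ltxx.
rewrite /cauchy -/h /contour.
have Im_split (b t r l : R[i]) : Im (b - t + 'i%C * (r - l)) =
    Im b - Im t + (Re r - Re l).
  by case: b t r l => [? ?] [? ?] [? ?] [? ?] /=; ring.
rewrite Im_split /=.
have {}bottom : 0 < Rint (-1) 1 (fun t => Im (h (Complex t (-1)))).
  apply: bottom => t /andP[t1 t2]; rewrite hE ImV !raddfB /=.
  have := ratio (- (-1 - Im z)) (t - Re z).
  by rewrite sqrrN mulNr [(-1 - Im z) ^+ 2 + _]addrC; apply; lra.
have {}top : Rint (-1) 1 (fun t => Im (h (Complex t 1))) < 0.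
  apply: top => t /andP[t1 t2]; rewrite hE ImV !raddfB /= lerN2.
  by rewrite [_ ^+ 2 + (1 - Im z) ^+ 2]addrC; apply: ratio; lra.
have {}right : 0 < Rint (-1) 1 (fun t => Re (h (Complex 1 t))).
  by apply: right => t /andP[t1 t2]; rewrite hE ReV !raddfB /=; apply: ratio; lra.
have {}left : Rint (-1) 1 (fun t => Re (h (Complex (-1) t))) < 0.
  apply: left => t /andP[t1 t2]; rewrite hE ReV !raddfB /= lerNr.
  by have := ratio (- (-1 - Re z)) (t - Im z); rewrite sqrrN mulNr; apply; lra.
by clear -bottom top right left; lra.
Qed.

(** If every [cauchy F m 0] vanishes, then [F z] times the winding integral equals
    [z ^+ m * cauchy F m z] for all [m], hence is at most [K / 2 ^+ m] in modulus and is zero.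
    Otherwise take the least [m] with a nonzero value and divide by the winding integral. *)
Lemma germ_dichotomy F : (forall u, cdiff F u) ->
  (forall z, cmod z <= 1 / 2 -> F z = 0) \/
  exists m G, [/\ cts G 0, G 0 != 0 & forall z, cmod z <= 1 / 2 -> F z = z ^+ m * G z].
Proof.
(* This [w] is the integral of [1 / (u - z)], not the weight of the operator. *)
move=> dF; pose w z := cauchy (fun=> 1) 0 z.
have w0 z : cmod z <= 1 / 2 -> w z != 0 by exact: winding_neq0.
have d1 u : cdiff (fun=> 1 : R[i]) u by exact: cdiff_cst.
have expand m : (forall k : nat, (k < m)%N -> cauchy F k 0 = 0) ->
    forall z, cmod z <= 1 / 2 -> F z * w z = z ^+ m * cauchy F m z.
  move=> Fm z z2; rewrite -cauchy_formula//.
  elim: m Fm => [|m IHm] Fm; first by rewrite expr0 mul1r.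
  rewrite IHm; last by move=> k /ltnW; exact: Fm.
  by rewrite (cauchy_step m dF z2) Fm// add0r mulrA exprSr.
have [[m Fm0]|all0] := pselect (exists m, cauchy F m 0 != 0); last first.
  left=> z z2; have [K HK] := cauchy_bounded dF.
  apply: (mulIf (w0 z z2)); rewrite mul0r.
  have Fz m : cmod (F z * w z) * 2 ^+ m <= K.
    rewrite (expand m) => [|k _|//]; last first.
      by apply/eqP; rewrite -[_ == _]negbK; apply/negP => h; apply: all0; exists k.
    rewrite cmodM cmodX mulrAC -exprMn.
    apply: (@le_trans _ _ (1 * cmod (cauchy F m z))); last by rewrite mul1r HK.
    rewrite ler_wpM2r ?cmod_ge0// exprn_ile1 ?mulr_ge0 ?cmod_ge0//.
    by clear -z2; lra.
  apply/eqP; rewrite -cmod_eq0 eq_le cmod_ge0 andbT leNgt; apply/negP => M0.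
  set M := cmod _ in Fz M0.
  have := Fz (Num.truncn (K / M)).+1; apply/negP; rewrite -ltNge.
  rewrite mulrC -ltr_pdivrMr//; apply: lt_trans (truncnS_gt _) _.
  by rewrite -natrX ltr_nat ltn_expl.
have exm : exists m, cauchy F m 0 != 0 by exists m.
right; case: (ex_minnP exm) => {Fm0}m Fm0 m_min.
exists m, (fun z => cauchy F m z * (w z)^-1); split.
- apply: ctsM; first exact: cts_cauchy.
  by apply: ctsV; [exact: w0|exact: cts_cauchy].
- by rewrite mulf_neq0// invr_eq0 w0.
- move=> z z2; have := expand m _ z z2; rewrite mulrA => <-.
    by rewrite mulfK// w0.
  move=> k km; apply/eqP; apply: contraLR km => /m_min; by rewrite -leqNgt.
Qed.

End Germ.

(** * Eigenfunctions of weighted composition operators *)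

Section Eigenfunctions.
Set Implicit Arguments.
Unset Strict Implicit.
Variable R : realType.
Implicit Types (a b c z t lam : R[i]) (w f g F G H : R[i] -> R[i]) (m n : nat).

Lemma cdiff_affine F a b : a != 0 -> (forall u, cdiff F u) ->
  forall u, cdiff (fun t => F (a * t + b)) u.
Proof.
move=> a0 dF u; have /cdiffRP[D HD] := dF (a * u + b).
apply/cdiffRP; exists (a * D) => e e0.
have ca0 : 0 < cmod a by rewrite cmod_gt0.
have [del del0 hdel] := HD (e / cmod a) (divr_gt0 e0 ca0).
exists (del / cmod a); first exact: divr_gt0.
move=> h h0; rewrite ltr_pdivlMr// => hlt.
have ah0 : a * h != 0 by exact: mulf_neq0.
have := hdel _ ah0; rewrite cmodM mulrC => /(_ hlt).
rewrite ltr_pdivlMr// mulrC -cmodM; congr (cmod _ < _).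
rewrite (_ : a * (u + h) + b = a * u + b + a * h); last by ring.
by field; rewrite a0 h0.
Qed.

Lemma small_point (del : R) : 0 < del ->
  exists t : R[i], [/\ t != 0, cmod t < del & cmod t <= 1 / 2].
Proof.
move=> del0; pose r := Num.min (del / 2) (1 / 2).
have r0 : 0 < r by rewrite lt_min !divr_gt0.
have cr : cmod r%:C = r by rewrite cmod_real ger0_norm// ltW.
exists r%:C; rewrite -cmod_gt0 cr r0; split => //.
  by rewrite gt_min ltr_pdivrMr// ltr_pMr// ltr1n.
by rewrite ge_min lexx orbT.
Qed.

(** Carries to the origin an identity obtained by cancelling a power of [t], hence known only for
    [t != 0]. *)
Lemma cts_eq0 H : cts H 0 ->
  (forall t, t != 0 -> cmod t <= 1 / 2 -> H t = 0) -> H 0 = 0.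
Proof.
move=> /ctsRP cH H0; apply/eqP; apply: contrapT => /negP.
rewrite -cmod_gt0 => /cH[del del0 hdel].
have [t [t0 tdel t2]] := small_point del0.
by have := hdel t; rewrite sub0r cmodN (H0 t t0 t2) subr0 ltxx => /(_ tdel).
Qed.

Lemma cts_neq0 G : cts G 0 -> G 0 != 0 ->
  exists2 del : R, 0 < del & forall t, cmod t < del -> G t != 0.
Proof.
move=> /ctsRP cG; rewrite -cmod_gt0 => /cG[del del0 hdel].
exists del => // t tdel; apply/eqP => Gt.
by have := hdel t; rewrite sub0r cmodN Gt subr0 ltxx => /(_ tdel).
Qed.

(** [G 0] is the leading coefficient. Continuity of [G] at the origin is all that comparing leading
    coefficients requires. *)
Definition has_order F m G :=
  [/\ cts G 0, G 0 != 0 & forall z, cmod z <= 1 / 2 -> F z = z ^+ m * G z].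

Lemma has_order_neq0 F m G : has_order F m G ->
  exists2 del : R, 0 < del &
    forall t, t != 0 -> cmod t < del -> cmod t <= 1 / 2 -> F t != 0.
Proof.
case=> cG G0 FG; have [del del0 hdel] := cts_neq0 cG G0.
by exists del => // t t0 tdel t2; rewrite FG// mulf_neq0 ?expf_neq0 ?hdel.
Qed.

(** Stands in for the identity theorem. If [F] vanished on the disc of radius 1/2, a dilation
    bringing [z1] into that disc would give a function that has an order, hence is nonzero at all
    small nonzero points, where [F] is zero by assumption. *)
Lemma entire_order F : (forall u, cdiff F u) -> (exists z, F z != 0) ->
  exists m G, has_order F m G.
Proof.
move=> dF [z1 Fz1]; case: (germ_dichotomy dF) => // F0.
have z10 : 0 < cmod z1.
  by rewrite cmod_gt0; apply: contraNneq Fz1 => ->; rewrite F0// cmod0 divr_ge0.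
(* With this factor, [z1 / r] has modulus exactly 1/2. *)
pose r : R[i] := (2 * cmod z1)%:C.
have cr : cmod r = 2 * cmod z1 by rewrite cmod_real ger0_norm// mulr_ge0// ltW.
have r0 : r != 0 by rewrite -cmod_gt0 cr mulr_gt0.
case: (germ_dichotomy (cdiff_affine 0 r0 dF)) => [Fr0|[m [G FrG]]].
  case/eqP: Fz1; have := Fr0 (z1 / r); rewrite addr0 [r * _]mulrC divfK//; apply.
  by rewrite cmodM cmodV cr invfM mulrA mulrAC divff ?gt_eqF.
have [del del0 hdel] := has_order_neq0 FrG.
have [|t [t0 tdel t2]] := @small_point (Num.min del (1 / 2 / cmod r)).
  by rewrite lt_min del0 !divr_gt0// cmod_gt0.
move: tdel; rewrite lt_min => /andP[tdel]; rewrite ltr_pdivlMr ?cmod_gt0// => tr.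
have /eqP[] := hdel t t0 tdel t2.
by rewrite addr0 F0// cmodM mulrC ltW.
Qed.

(** * Eigenfunctions when the fixed point is the origin *)

Section Multiplier.
Variables (a : R[i]) (w : R[i] -> R[i]) (lam : R[i]).
Hypotheses (a0 : 0 < cmod a) (a1 : cmod a < 1).
Hypothesis dw : forall u, cdiff w u.

Let an0 : a != 0. Proof. by rewrite -cmod_gt0. Qed.

Let scaled_le t : cmod (a * t) <= cmod t.
Proof. by rewrite cmodM; exact: ler_piMl (cmod_ge0 t) (ltW a1). Qed.

Lemma cts_scaled G : cts G 0 -> cts (fun t => G (a * t)) 0.
Proof.
move=> /ctsRP cG; apply/ctsRP => e e0; have [del del0 hdel] := cG e e0.
exists del => // t; rewrite sub0r cmodN => tdel; rewrite mulr0; apply: hdel.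
by rewrite sub0r cmodN (le_lt_trans (scaled_le t)).
Qed.

(** Divide the eigenvalue equation by [t ^+ m], let [t] tend to 0 and cancel [G 0]. *)
Lemma eigenvalue_order f m G : has_order f m G ->
  (forall t, w t * f (a * t) = lam * f t) -> lam = w 0 * a ^+ m.
Proof.
move=> [cG G0 fG] eig; pose H t := w t * a ^+ m * G (a * t) - lam * G t.
have cH : cts H 0.
  apply: ctsB; last by apply: ctsM => //; exact: cts_cst.
  apply: ctsM; last exact: cts_scaled.
  by apply: ctsM; [exact: cdiff_cts|exact: cts_cst].
have : H 0 = 0.
  apply: cts_eq0 => // t t0 t2; apply: (mulfI (expf_neq0 m t0)); rewrite mulr0.
  have := eig t; rewrite fG ?(le_trans (scaled_le t))// fG// exprMn => /eqP.
  rewrite -subr_eq0 => /eqP <-; rewrite /H; ring.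
rewrite /H mulr0 -mulrBl => /eqP; rewrite mulf_eq0 (negPf G0) orbF subr_eq0.
by move=> /eqP.
Qed.

Lemma centered_eigenspace f g : (forall u, cdiff f u) -> (forall u, cdiff g u) ->
  (exists z, w z != 0) -> (exists z, f z != 0) ->
  (forall t, w t * f (a * t) = lam * f t) ->
  (forall t, w t * g (a * t) = lam * g t) ->
  exists c, forall t, g t = c * f t.
Proof.
move=> df dg w_nz f_nz eigf eigg.
have [m [Gf ordf]] := entire_order df f_nz.
(* Otherwise [w t * f (a * t)] vanishes identically, although near the origin both factors are
   nonzero for [t != 0]. *)
have lam0 : lam != 0.
  apply/eqP => lam0; have [k [Gw ordw]] := entire_order dw w_nz.
  have [df1 df0 hf] := has_order_neq0 ordf.
  have [dw1 dw0 hw] := has_order_neq0 ordw.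
  have [|t [t0 + t2]] := @small_point (Num.min df1 dw1); first by rewrite lt_min df0.
  rewrite lt_min => /andP[tf tw]; have := eigf t; rewrite lam0 mul0r => /eqP.
  apply/negP; apply: mulf_neq0; first exact: hw.
  apply: hf; first exact: mulf_neq0.
    exact: le_lt_trans (scaled_le t) tf.
  exact: le_trans (scaled_le t) t2.
have lamf := eigenvalue_order ordf eigf.
(* Since [lam != 0] forces [w 0 != 0], the two expressions of [lam] give [a ^+ m = a ^+ n]; taking
   moduli yields [m = n]. *)
have order_unique h n Gh : has_order h n Gh ->
    (forall t, w t * h (a * t) = lam * h t) -> n = m.
  move=> ordh eigh; have := eigenvalue_order ordh eigh; rewrite {1}lamf => E.
  have w00 : w 0 != 0 by apply: contraNneq lam0 => w00; rewrite lamf w00 mul0r.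
  have /(congr1 (@cmod R)) := mulfI w00 E; rewrite !cmodX.
  by move/(ieexprIn a0 (negbT (lt_eqF a1))).
have [g_nz|g0] := pselect (exists z, g z != 0); last first.
  exists 0 => t; rewrite mul0r; apply/eqP; apply: contrapT => /negP gt.
  by apply: g0; exists t.
have [n [Gg ordg]] := entire_order dg g_nz.
have nm := order_unique _ _ _ ordg eigg; subst n.
case: ordf ordg => cGf Gf0 fG [cGg Gg0 gG].
(* This [c] cancels the leading coefficients. If [h = g - c f] were nonzero, it would be an
   eigenfunction for [lam], again of order [m], with leading coefficient [Gg 0 - c * Gf 0 = 0], a
   contradiction. *)
pose c := Gg 0 / Gf 0; exists c => t; apply/eqP; apply: contrapT => /negP ht.
pose h t := g t - c * f t.
have dh u : cdiff h u.
  by apply: cdiffB => //; apply: cdiffM => //; exact: cdiff_cst.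
have eigh t' : w t' * h (a * t') = lam * h t'.
  by rewrite /h mulrBr mulrCA eigf eigg; ring.
have [k [Gh ordh]] : exists k Gh, has_order h k Gh.
  by apply: entire_order => //; exists t; rewrite subr_eq0.
have km := order_unique _ _ _ ordh eigh; subst k.
case: ordh => cGh Gh0 hG.
pose H s := Gh s - (Gg s - c * Gf s).
have cH : cts H 0.
  by apply: ctsB => //; apply: ctsB => //; apply: ctsM => //; exact: cts_cst.
have : H 0 = 0.
  apply: cts_eq0 => // s s0 s2; apply: (mulfI (expf_neq0 m s0)); rewrite mulr0.
  by have := hG s s2; rewrite /h fG// gG// => E; rewrite /H mulrBr -E; ring.
by rewrite /H /c divfK// subrr subr0 => /eqP; rewrite (negPf Gh0).
Qed.

End Multiplier.
End Eigenfunctions.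

Theorem theorem3p5 (R : realType) (nu : R) (a b : R[i]) (w : R[i] -> R[i]) :
  1 <= nu ->
  0 < cmod a -> cmod a < 1 ->
  entire w -> (exists z, w z != 0) ->
  wco_compact nu w (fun z => a * z + b) ->
  forall (lam : R[i]) (f : R[i] -> R[i]),
    wco_eigen nu w (fun z => a * z + b) lam f ->
    forall g : R[i] -> R[i],
      in_fock nu g -> (forall z, wco w (fun z => a * z + b) g z = lam * g z) ->
      exists c : R[i], forall z, g z = c * f z.
Proof.
move=> _ a0 a1 /entireP dw [zw wz] _ lam f [[/entireP df _] [[zf fz] eigf]].
(* [z0] is the fixed point of the affine map; translating by it turns the map into [t] to
   [a * t]. *)
move=> g [/entireP dg _] eigg; pose z0 := b / (1 - a).
have a_neq1 : 1 - a != 0.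
  by rewrite subr_eq0 eq_sym; apply: contraTneq a1 => ->; rewrite cmod1 ltxx.
(* The translation is written [1 * t + z0] so that [cdiff_affine] applies with multiplier 1. *)
have shift F t : wco w (fun z => a * z + b) F (1 * t + z0) =
    w (1 * t + z0) * F (1 * (a * t) + z0).
  by rewrite /wco; congr (_ * F _); rewrite /z0; field.
have nz F z : F z != 0 -> exists t, F (1 * t + z0) != 0.
  by exists (z - z0); rewrite mul1r subrK.
have n10 : 1 != 0 :> R[i] by exact: oner_neq0.
have [c gc] : exists c, forall t, g (1 * t + z0) = c * f (1 * t + z0).
  apply: (centered_eigenspace (lam := lam) a0 a1 (cdiff_affine z0 n10 dw)
      (cdiff_affine z0 n10 df) (cdiff_affine z0 n10 dg)).
  - exact: nz wz.
  - exact: nz fz.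
  - by move=> t; rewrite -shift eigf.
  - by move=> t; rewrite -shift eigg.
by exists c => z; have := gc (z - z0); rewrite mul1r subrK.
Qed.
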